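(* Let $\mathcal R$ be either $(\mathbb R,<,+,0)$ or $(\mathbb R,<,+,0,\Lambda)$, where $\Lambda$ is the set of all real scalar functions on $\mathbb R$. Let $D$ be a countable subset of $\mathbb R$ such that $(\mathcal R,D)$ is locally o-minimal. Let $E$ be a compact subset of $\mathbb R$ which is a union of finitely many discrete sets. Then $(\mathcal R,D\cup E)^{\#}$ is d-minimal.
   Context: The real scalar functions on $\mathbb R$ are the maps $x\mapsto \lambda x$, $\lambda\in\mathbb R$. ''Definable'' means definable with parameters. A subset of a topological space is discrete if its subspace topology is discrete. An expansion $(M,<,\ldots)$ of a dense linear order without endpoints is locally o-minimal if for every definable subset $X$ of $M$ and every point $a\in M$ there exists an open interval $I$ with $a\in I$ such that $X\cap I$ is a finite union of points and open intervals. $(\mathcal R,D)$ denotes the expansion of $\mathcal R$ by a unary predicate for $D$. For an o-minimal expansion $\mathcal R$ of $(\mathbb R,<,+)$ and $F\subseteq\mathbb R$, $(\mathcal R,F)^{\#}$ denotes the expansion of $\mathcal R$ by predicates for all nonempty subsets $S$ of all Cartesian powers $F^k$ ($k$ ranging over all positive integers). An expansion $\mathcal R$ of the ordered set of reals $(\mathbb R,<)$ is d-minimal if either one of (equivalently, both of) the following equivalent conditions holds: (1) for every $\mathcal M\equiv\mathcal R$ with universe $M$, every subset of $M$ definable in $\mathcal M$ is the union of an open set and finitely many discrete sets; (2) for every nonnegative integer $n$ and every definable set $A\subseteq\mathbb R^{n+1}$ there exists a positive integer $N$ such that for each $x\in\mathbb R^n$ the fiber $A_x:=\{y\in\mathbb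 R\mid (x,y)\in A\}$ either has nonempty interior or is the union of at most $N$ discrete sets. *)

(* Defs.v *)
From HB Require Import structures.
From mathcomp Require Import all_boot all_order all_algebra.
From mathcomp Require Import all_classical all_reals all_analysis.
Set Implicit Arguments.
Unset Strict Implicit.
Unset Printing Implicit Defensive.
Import Order.TTheory GRing.Theory Num.Theory.
Import numFieldNormedType.Exports.
Local Open Scope classical_set_scope.
Local Open Scope ring_scope.

(* A first-order structure with universe T, bundled with its language;
   tuples of length n are functions 'I_n -> T. *)
Record fo_structure (T : Type) := FoStructure {
  fsym : Type;
  far : fsym -> nat;
  fint : forall f : fsym, ('I_(far f) -> T) -> T;
  rsym : Type;
  rar : rsym -> nat;
  rint : forall r : rsym, set ('I_(rar r) -> T) }.

Section Formulas.
Context {T : Type} (M : fo_structure T).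

Inductive term :=
| Var (i : nat)
| App (f : fsym M) (t : 'I_(far f) -> term).

(* The remaining connectives and the existential quantifier are recovered
   classically. *)
Inductive formula :=
| Bot
| Eq (t u : term)
| Rel (r : rsym M) (t : 'I_(rar r) -> term)
| Imp (p q : formula)
| All (i : nat) (p : formula).

Fixpoint eval (e : nat -> T) (t : term) : T :=
  match t with
  | Var i => e i
  | App f t => fint (fun j => eval e (t j))
  end.

Definition update (e : nat -> T) (i : nat) (a : T) : nat -> T :=
  fun j => if j == i then a else e j.

Fixpoint sat (e : nat -> T) (p : formula) : Prop :=
  match p with
  | Bot => False
  | Eq t u => eval e t = eval e u
  | Rel r t => rint (fun j => eval e (t j))
  | Imp p q => sat e p -> sat e q
  | All i p => forall a : T, sat (update e i a) p
  end.

(* The variables 0, ..., n-1 are assigned the tuple x, all others the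
   parameters c. *)
Definition assign n (x : 'I_n -> T) (c : nat -> T) : nat -> T :=
  fun i => if insub i is Some j then x j else c i.

(* Definability with parameters: only finitely many values of c matter for a
   given formula. *)
Definition definable n (A : set ('I_n -> T)) : Prop :=
  exists (p : formula) (c : nat -> T), forall x, A x <-> sat (assign x c) p.

End Formulas.

Definition unary_set {T : Type} (X : set T) : set ('I_1 -> T) :=
  [set v | X (v ord0)].

Definition expand {T : Type} (M : fo_structure T) (I : Type) (ar : I -> nat)
    (P : forall i, set ('I_(ar i) -> T)) : fo_structure T :=
  @FoStructure T (fsym M) (@far T M) (@fint T M) (rsym M + I)%type
    (fun s => match s with inl r => rar r | inr i => ar i end)
    (fun s => match s with inl r => @rint T M r | inr i => P i end).

(* (M, D) *)
Definition expand_set {T : Type} (M : fo_structure T) (D : set T) :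
    fo_structure T :=
  expand M (fun _ : unit => unary_set D).

Record sharp_pred {T : Type} (F : set T) := SharpPred {
  sharp_arity : nat;
  sharp_set : set ('I_sharp_arity -> T);
  sharp_arity_gt0 : (0 < sharp_arity)%N;
  sharp_set_neq0 : sharp_set !=set0;
  sharp_set_sub : sharp_set `<=` [set v | forall i, F (v i)] }.

(* (M, F)^# *)
Definition sharp {T : Type} (M : fo_structure T) (F : set T) :
    fo_structure T :=
  expand M (@sharp_set T F).

Section Reals.
Context {R : realType}.
Implicit Types (M : fo_structure R) (X : set R).

Definition open_interval (a b : \bar R) : set R :=
  [set x : R | (a < x%:E)%E /\ (x%:E < b)%E].

(* Vacuous intervals (b <= a) may occur in t; they contribute nothing. *)
Definition finite_union_points_intervals X : Prop :=
  exists (s : seq R) (t : seq (\bar R * \bar R)),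
    X = [set` s] `|` \bigcup_(p in [set` t]) open_interval p.1 p.2.

(* For M an expansion of (R, <). *)
Definition locally_o_minimal M : Prop :=
  forall X, definable M (unary_set X) ->
  forall a : R, exists b c : \bar R,
    open_interval b c a /\
    finite_union_points_intervals (X `&` open_interval b c).

(* X is coerced to its subtype, which carries the subspace topology. *)
Definition discrete_subset X : Prop := forall U : set X, open U.

(* "At most N": some of the F i may be empty or coincide. *)
Definition union_of_discrete (N : nat) X : Prop :=
  exists F : 'I_N -> set R,
    (forall i, discrete_subset (F i)) /\ X = \bigcup_i F i.

Definition snoc n (x : 'I_n -> R) (y : R) : 'I_n.+1 -> R :=
  fun i => if unlift ord_max i is Some j then x j else y.

Definition fiber n (A : set ('I_n.+1 -> R)) (x : 'I_n -> R) : set R :=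
  [set y | A (snoc x y)].

(* For M an expansion of (R, <). *)
Definition d_minimal M : Prop :=
  forall n (A : set ('I_n.+1 -> R)), definable M A ->
  exists N : nat, (0 < N)%N /\
    forall x : 'I_n -> R,
      (fiber A x)° !=set0 \/ union_of_discrete N (fiber A x).

End Reals.

Section Base.
Variable R : realType.

Inductive group_fsym := GZero | GAdd.

Definition group_far (f : group_fsym) : nat :=
  match f with GZero => 0 | GAdd => 2 end.

Definition group_fint (f : group_fsym) : ('I_(group_far f) -> R) -> R :=
  match f with
  | GZero => fun=> 0
  | GAdd => fun v => v ord0 + v ord_max
  end.

Definition order_rint (_ : unit) : set ('I_2 -> R) :=
  [set v | v ord0 < v ord_max].

(* (R, <, +, 0) *)
Definition ordered_group : fo_structure R :=
  FoStructure group_fint order_rint.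

Definition vspace_far (f : group_fsym + R) : nat :=
  match f with inl g => group_far g | inr _ => 1 end.

Definition vspace_fint (f : group_fsym + R) : ('I_(vspace_far f) -> R) -> R :=
  match f with
  | inl g => @group_fint g
  | inr l => fun v => l * v ord0
  end.

(* (R, <, +, 0, Lambda): the function symbol inr l is x |-> l * x. *)
Definition ordered_vspace : fo_structure R :=
  FoStructure vspace_fint order_rint.

End Base.

(* Main.v *)
Require Import Defs.
From mathcomp Require Import all_boot all_order all_algebra.
From mathcomp Require Import all_classical all_reals all_analysis.
From mathcomp Require Import ring lra.
Import numFieldNormedType.Exports.
Local Open Scope classical_set_scope.
Local Open Scope ring_scope.
Import Order.TTheory GRing.Theory Num.Theory.

(** Call two reals equivalent for a set G when they compare in the same way
    with every point of G (same_cut): they are the same point of G, or lie in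
    the same gap of G.  The proof shows that every definable set is a union of
    sets cut out by finitely many conditions, each of which prescribes the
    class of a linear form for G.  Here G ranges over a family of closed sets of
    finite Cantor-Bendixson rank, that is, sets whose n-th derived set is empty
    for some n.  Parameters need no constants, because the forms are functions
    of the whole assignment of the variables.

    Atomic formulas are of this kind: order and equality compare a difference
    of terms with 0, and a subset of F^k, F = D `|` E, only depends on the
    classes of its arguments for F, since equivalent points of F are equal.
    The step that eliminates a quantifier is an elementary back-and-forth
    (cut_transfer): the classes of y - u_1, ..., y - u_k for H that are
    realised by some y only depend on the classes of the differences u_i - u_j
    for the difference set H - H.  Either y - u_i is a point h of H, and the
    point u_i' + h does it for the translates by u', or y lies in an
    intersection of gaps, whose end points are attained because H is closed,
    and the corresponding end points bound a nonempty intersection for u'.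
    As a consequence (cut_structure_d_minimal), a fibre in one variable either
    contains a neighbourhood of one of its points or lies in a finite union of
    affine preimages of G; the rank of that union does not exceed the rank of
    G, so the layers of its derived sets give a uniform number of discrete
    sets.

    It remains to find a family of closed sets of finite rank that contains F
    and is stable, up to supersets, under union, difference and the scalars of
    the language.  The sums P + K do it, with P a countable set definable in
    the expansion by D and K a compact set of finite rank (tame_sum).  Local
    o-minimality makes P discrete and closed (locally_o_minimal_limit_point),
    and it applies to all P at once since differences and multiples of
    definable sets are definable.  Addition is proper on P * K, and a proper
    map sends limit points to limit points, in the sense that each limit point
    of an image is the image of a limit point (limit_point_image); hence P + K
    is closed, and its rank is bounded by that of P * K. *)

(** * Limit points, iterated derived sets and discrete sets *)

Section LimitPoints.
Context {T : topologicalType}.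
Implicit Types X Y : set T.

Lemma not_limit_point_near X x :
  ~ limit_point X x -> \forall y \near x, X y -> y = x.
Proof.
rewrite not_limit_pointE => -[U xU XU].
by apply: filterS xU => y Uy Xy; exact: XU.
Qed.

Lemma limit_point_mono {X Y} : X `<=` Y -> limit_point X `<=` limit_point Y.
Proof.
by move=> XY x Xx U /Xx[y [yx Xy Uy]]; exists y; split=> //; exact: XY.
Qed.

Lemma limit_pointU X Y :
  limit_point (X `|` Y) `<=` limit_point X `|` limit_point Y.
Proof.
move=> x XYx; apply: contrapT => /not_orP[/not_limit_point_near Xx].
move=> /not_limit_point_near Yx.
have [y [/eqP yx XYy [Xyx Yyx]]] := XYx _ (filterI Xx Yx).
by case: XYy => [/Xyx|/Yyx].
Qed.

Lemma closed_limit_point_sub {X} : closed X -> limit_point X `<=` X.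
Proof. by move=> cX x /subset_limit_point/cX. Qed.

Lemma derived_sub {X} n : closed X -> iter n limit_point X `<=` X.
Proof.
move=> cX; elim: n => //= n IHn.
by apply: subset_trans (closed_limit_point_sub cX); exact: limit_point_mono.
Qed.

Lemma derived_mono {X Y} n :
  X `<=` Y -> iter n limit_point X `<=` iter n limit_point Y.
Proof. by move=> XY; elim: n => //= n; exact: limit_point_mono. Qed.

Lemma derivedU X Y n : iter n limit_point (X `|` Y) `<=`
  iter n limit_point X `|` iter n limit_point Y.
Proof.
elim: n => //= n IHn; apply: subset_trans (limit_pointU _ _).
exact: limit_point_mono.
Qed.

Lemma derived0 n : iter n limit_point (@set0 T) `<=` set0.
Proof.
elim: n => //= n IHn x /(limit_point_mono IHn)/(_ setT filterT).
by case=> ? [].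
Qed.

Lemma derived_widen X m n : closed X -> (m <= n)%N ->
  iter n limit_point X `<=` iter m limit_point X.
Proof.
move=> cX /subnK <-; rewrite addnC iterD.
by apply: derived_mono; exact: derived_sub.
Qed.

Lemma derived_bigcup0 (I : finType) (X : I -> set T) n :
  (forall i, iter n limit_point (X i) `<=` set0) ->
  iter n limit_point (\bigcup_i X i) `<=` set0.
Proof.
move=> X0; suff : iter n limit_point (\bigcup_(i in [set` enum I]) X i) `<=` set0.
  apply: subset_trans; apply: derived_mono => x [i _ Xix].
  by exists i => //=; rewrite mem_enum.
rewrite bigcup_seq; elim: (enum I) => [|i s IHs].
  by rewrite big_nil; exact: derived0.
rewrite big_cons; apply: subset_trans (derivedU _ _ _) _.
by rewrite subUset; split.
Qed.

End LimitPoints.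

Lemma closedX {T S : topologicalType} (X : set T) (Y : set S) :
  closed X -> closed Y -> closed (X `*` Y).
Proof.
move=> cX cY; rewrite (_ : X `*` Y = fst @^-1` X `&` snd @^-1` Y)//.
apply: closedI; apply: closed_comp => // x _; [exact: cvg_fst|exact: cvg_snd].
Qed.

(** A point with both coordinates isolated is isolated in the product. *)
Lemma limit_pointX {T S : topologicalType} (X : set T) (Y : set S) :
  closed X -> closed Y ->
  limit_point (X `*` Y) `<=` limit_point X `*` Y `|` X `*` limit_point Y.
Proof.
move=> cX cY [a b] XYab; apply: contrapT => /not_orP[nX nY].
have Xa : X a.
  apply: cX => U /= Ua; have [|[y z] [_ [Xy _] [Uy _]]] := XYab (U `*` setT).
    by exists (U, setT) => //; split=> //; exact: filterT.
  by exists y.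
have Yb : Y b.
  apply: cY => U /= Ub; have [|[y z] [_ [_ Yz] [_ Uz]]] := XYab (setT `*` U).
    by exists (setT, U) => //; split=> //; exact: filterT.
  by exists z.
have /not_limit_point_near Xa' : ~ limit_point X a by move=> ?; exact: nX.
have /not_limit_point_near Yb' : ~ limit_point Y b by move=> ?; exact: nY.
have [|[y z] [/eqP yz [Xy Yz] [Hy Hz]]] :=
  XYab ([set y | X y -> y = a] `*` [set y | Y y -> y = b]).
  by exists ([set y | X y -> y = a], [set y | Y y -> y = b]).
by apply: yz; congr pair; [exact: Hy|exact: Hz].
Qed.

(** Deriving a product leaves a union of two products, in each of which one
    factor has been derived, so ranks add up at most. *)
Lemma derivedX {T S : topologicalType} (X : set T) (Y : set S) m n :
  accessible_space T -> accessible_space S -> closed X -> closed Y ->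
  iter m limit_point X `<=` set0 -> iter n limit_point Y `<=` set0 ->
  iter (m + n) limit_point (X `*` Y) `<=` set0.
Proof.
move=> aT aS; move Ek : (m + n)%N => k.
elim: k m n X Y Ek => [|k IHk] [|m] [|n] X Y //.
- by move=> _ _ _ X0 _ /= [x y] /= [/X0].
- move=> _ _ _ X0 _; apply: subset_trans (derived0 k.+1).
  by apply: derived_mono => -[x y] [/X0].
- move=> _ _ _ _ Y0; apply: subset_trans (derived0 k.+1).
  by apply: derived_mono => -[x y] [_ /Y0].
rewrite addSn => -[Ek] cX cY X0 Y0.
have cX' := limit_point_closed X aT; have cY' := limit_point_closed Y aS.
rewrite iterSr; apply: subset_trans (derived_mono _ (limit_pointX _ _ cX cY)) _.
apply: subset_trans (derivedU _ _ _) _; rewrite subUset; split.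
  by apply: (IHk m n.+1) => //; rewrite -iterSr.
by apply: (IHk m.+1 n) => //; rewrite ?addSnnS// -iterSr.
Qed.

(** Besides all maps on compact sets, this covers addition on P * K for P
    closed and unbounded and K compact. *)
Definition locally_proper {T S : topologicalType} (f : T -> S) (X : set T) :=
  forall z : S, exists2 U, nbhs z U & exists2 C, compact C & X `&` f @^-1` U `<=` C.

Lemma compact_locally_proper {T S : topologicalType} (f : T -> S) X :
  compact X -> locally_proper f X.
Proof.
by move=> cX z; exists setT; [exact: filterT|exists X => // x []].
Qed.

Section LocallyProper.
Context {T S : topologicalType} (f : T -> S).
Hypotheses (cf : continuous f) (hS : hausdorff_space S).

(** By compactness only the points x over z matter.  The hypothesis says that
    near each of them the map is constant on X. *)
Lemma locally_proper_isolated {X : set T} z : closed X -> locally_proper f X ->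
  (forall x, X x -> f x = z -> \forall y \near x, X y -> f y = z) ->
  \forall v \near z, (f @` X) v -> v = z.
Proof.
move=> cX pX fz; have [U zU [C cC XC]] := pX z.
suff : \forall v \near z, C `<=` [set y | X y -> f y = v -> v = z].
  apply: filterS2 zU => v Uv Cv [y Xy fyv].
  by apply: (Cv y) => //; apply: XC; split=> //=; rewrite fyv.
move/compact_near_coveringP: cC.
apply=> x Cx; have [[Xx fxz]|nx] := pselect (X x /\ f x = z).
  exists ([set y | X y -> f y = z], setT).
    by split; [exact: fz|exact: filterT].
  by move=> [y v] [/= Hy _] /Hy -> .
have [Xx|nXx] := pselect (X x); last first.
  exists (~` X, setT); last by move=> [y v] [/= nXy _] /nXy.
  by split; [apply: open_nbhs_nbhs; split=> //; exact: closed_openC|exact: filterT].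
have /eqP fxz : f x <> z by move=> fxz; exact: nx.
have := hS; rewrite open_hausdorff => /(_ _ _ fxz).
case=> -[A B] /= [/set_mem Ax /set_mem Bz] [oA oB /eqP AB].
exists (f @^-1` A, B).
  by split; [apply: cf|]; apply: open_nbhs_nbhs.
move=> [y v] /= [Afy Bv] Xy fyv; have : (A `&` B) v by split=> //; rewrite -fyv.
by rewrite AB.
Qed.

Lemma locally_proper_closed {X : set T} :
  closed X -> locally_proper f X -> closed (f @` X).
Proof.
move=> cX pX z zX; apply: contrapT => nz.
have /zX[v [Xv /= /(_ Xv) vz]] :=
  locally_proper_isolated z cX pX (fun x Xx fxz => False_ind _ (nz (ex_intro2 _ _ x Xx fxz))).
by rewrite vz in Xv.
Qed.

(** If no point over z is a limit point of X, then the map is constant on X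
    near each such point, and z is isolated in the image. *)
Lemma limit_point_image {X : set T} : closed X -> locally_proper f X ->
  limit_point (f @` X) `<=` f @` limit_point X.
Proof.
move=> cX pX z zX; apply: contrapT => nz.
have /(locally_proper_isolated z cX pX) : forall x, X x -> f x = z ->
    \forall y \near x, X y -> f y = z.
  move=> x Xx fxz; have /not_limit_point_near : ~ limit_point X x.
    by move=> Xx'; apply: nz; exists x.
  by apply: filterS => y yx /yx ->.
by move=> /zX[v [/eqP vz Xv /(_ Xv)]].
Qed.

Lemma derived_image {X : set T} n : accessible_space T ->
  closed X -> locally_proper f X ->
  iter n limit_point (f @` X) `<=` f @` iter n limit_point X.
Proof.
move=> aT; elim: n X => [X _ _ //|n IHn X cX pX]; rewrite !iterSr.
apply: subset_trans (derived_mono _ (limit_point_image cX pX)) _.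
apply: IHn; first exact: limit_point_closed.
move=> z; have [U zU [C cC XC]] := pX z; exists U => //; exists C => //.
by move=> x [/(closed_limit_point_sub cX) Xx Ux]; apply: XC.
Qed.

Lemma derived_preimage (Y : set S) n : injective f ->
  iter n limit_point (f @^-1` Y) `<=` f @^-1` iter n limit_point Y.
Proof.
move=> injf; elim: n => //= n IHn x xY U fxU.
have [y [yx /IHn Yy Uy]] := xY _ (cf _ _ fxU).
by exists (f y); split=> //; rewrite (inj_eq injf).
Qed.

End LocallyProper.

Section Discrete.
Context {R : realType}.
Implicit Types X : set R.

Lemma discrete_subsetP X :
  discrete_subset X <-> forall x, X x -> ~ limit_point X x.
Proof.
split=> [dX x Xx|dX U].
  have [/= V oV VE] := dX [set (exist _ x (mem_set Xx) : X)].
  rewrite not_limit_pointE; exists V.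
    apply: open_nbhs_nbhs; split=> //.
    have : (set_val @^-1` V) (exist _ x (mem_set Xx) : X) by rewrite VE.
    by [].
  move=> y [Xy Vy].
  have : (set_val @^-1` V) (exist _ y (mem_set Xy) : X) by [].
  by rewrite VE => /(congr1 set_val).
exists (\bigcup_(W in [set W | open W /\
  exists2 u : X, U u & W `&` X `<=` [set set_val u]]) W).
  by apply: bigcup_open => W [].
apply/seteqP; split=> [x [W [oW [u Uu WX]] /= Wx]|x Ux].
  have /= xu : set_val x = set_val u.
    by apply: WX; split=> //; exact: set_valP.
  by rewrite (val_inj xu).
have := dX _ (set_valP x); rewrite not_limit_pointE => -[V].
rewrite nbhsE => -[W [oW Wx] WV] XV.
exists W => //; split=> //; exists x => // y [Wy Xy].
by apply: XV; split=> //; exact: WV.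
Qed.

Lemma discrete_subsetS {X Y : set R} :
  X `<=` Y -> discrete_subset Y -> discrete_subset X.
Proof.
move=> XY /discrete_subsetP dY; apply/discrete_subsetP => x Xx.
by move=> /(limit_point_mono XY); apply: dY; exact: XY.
Qed.

(** The points that disappear at the (i+1)-st derivation form a discrete set,
    so a set of rank at most N has N layers. *)
Lemma union_of_discrete_sub N (A X : set R) : A `<=` X ->
  iter N limit_point X `<=` set0 -> union_of_discrete N A.
Proof.
move=> AX X0.
exists (fun i : 'I_N => A `&` (iter i limit_point X `\` iter i.+1 limit_point X)).
split=> [i|].
  apply/discrete_subsetP => x [_ [_ nx]] xi; apply: nx => /=.
  by apply: limit_point_mono xi => y [_ []].
apply/seteqP; split=> [x Ax|x [i _ []]//].
have exn : exists n, ~~ `[< iter n limit_point X x >].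
  by exists N; apply/asboolPn => /X0.
case: (ex_minnP exn) => -[|n] /asboolPn nx minx; first by case: nx; exact: AX.
have xn : iter n limit_point X x.
  apply: contrapT => /asboolPn/minx; by rewrite ltnn.
have nN : (n < N)%N.
  rewrite ltnNge; apply/negP => Nn.
  have /minx : ~~ `[< iter N limit_point X x >] by apply/asboolPn => /X0.
  by move=> nN; have := leq_trans nN Nn; rewrite ltnn.
by exists (Ordinal nN).
Qed.

(** Around a point x of one of the N discrete sets, the punctured set is locally
    a union of the N - 1 others, so x survives at most N - 1 derivations.  The
    induction runs over all open subsets, since puncturing destroys
    closedness. *)
Lemma closed_union_of_discrete N (E : set R) : closed E -> union_of_discrete N E ->
  iter N limit_point E `<=` set0.
Proof.
move=> cE E_N.
suff H : forall N (U : set R), open U -> union_of_discrete N (E `&` U) ->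
    iter N limit_point E `&` U `<=` set0.
  by rewrite -[X in X `<=` _]setIT; apply: H; [exact: openT|rewrite setIT].
elim=> {N E_N}[|N IHN] U oU [F [dF EF]].
  by rewrite /= EF => x [[]].
move=> x [xE Ux]; have Ex := derived_sub N.+1 cE _ xE.
have [i _ Fix] : (\bigcup_i F i) x by rewrite -EF.
have /discrete_subsetP/(_ _ Fix)/not_limit_point_near nFx := dF i.
have : nbhs x [set y | F i y -> y = x] by exact: nFx.
rewrite nbhsE => -[V [oV Vx] VF].
have /xE /= : nbhs x (U `&` V) by apply: filterI; apply: open_nbhs_nbhs.
move=> [y [yx Ey [Uy Vy]]].
apply: (IHN (U `&` V `&` ~` [set x]) _ _ y); last first.
- by split=> //; split=> //; apply/eqP.
- exists (fun j => F (lift i j) `&` (V `&` ~` [set x])); split.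
    by move=> j; apply: discrete_subsetS (dF (lift i j)) => z [].
  apply/seteqP; split=> [z [Ez [[Uz Vz] zx]]|z [j _ [Fz [Vz zx]]]].
    have [j _] : (\bigcup_i F i) z by rewrite -EF.
    case: (unliftP i j) => [k ->|->] Fz; first by exists k.
    by case: zx; apply: VF.
  by have [] : (E `&` U) z by rewrite EF; exists (lift i j).
- apply: openI; first exact: openI.
  exact/closed_openC/closed_eq.
Qed.

End Discrete.

(** * Cuts of the line in closed sets *)

Section Cuts.
Context {R : realType}.
Implicit Types (G H : set R) (u v w z t : R).

Definition diff_set A B : set R := [set a - b | a in A & b in B].

(** The sign also records whether u is equal to t: for u in G the condition
    forces v = u, and otherwise u and v lie in the same gap of G.  Enlarging G
    makes the relation finer. *)
Definition same_cut G u v := forall t, G t -> Num.sg (u - t) = Num.sg (v - t).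

Lemma same_cutS G H u v : G `<=` H -> same_cut H u v -> same_cut G u v.
Proof. by move=> GH uv t /GH/uv. Qed.

Lemma same_cut_sym G u v : same_cut G u v -> same_cut G v u.
Proof. by move=> uv t /uv. Qed.

Lemma same_cut_mem G u v : same_cut G u v -> G u -> v = u.
Proof.
by move=> uv /uv; rewrite subrr sgr0 => /esym/eqP; rewrite sgr_eq0 subr_eq0 => /eqP.
Qed.

Lemma same_cut_scale k G H u v : k != 0 -> [set k * g | g in G] `<=` H ->
  same_cut H (k * u) (k * v) -> same_cut G u v.
Proof.
move=> k0 GH uv t Gt; have /uv : H (k * t) by apply: GH; exists t.
by rewrite -!mulrBr !sgrM => /mulfI; apply; rewrite sgr_eq0.
Qed.

Lemma near_same_cut G u : closed G -> ~ G u -> \forall v \near u, same_cut G u v.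
Proof.
move=> cG nGu; have : nbhs u (~` G).
  by apply: open_nbhs_nbhs; split=> //; exact: closed_openC.
move=> /nbhs_ballP[r /= r0 rG]; apply/nbhs_ballP; exists r => //= v /= uv t Gt.
have : ~ `|u - t| < r by move=> ut; exact: (rG t).
move: uv; rewrite /ball/= => uv /negP; rewrite -leNgt => ut.
have [tu|ut'|tu] := ltgtP t u.
- have tv : t < v.
    move: ut; rewrite gtr0_norm ?subr_gt0//; move: uv; rewrite ltr_norml; lra.
  by rewrite !gtr0_sg ?subr_gt0.
- have vt : v < t.
    move: ut; rewrite ltr0_norm ?subr_lt0//; move: uv; rewrite ltr_norml; lra.
  by rewrite !ltr0_sg ?subr_lt0.
- by move: ut; rewrite tu subrr normr0 leNgt r0.
Qed.

(** The list is empty if the gap around w is unbounded below; otherwise it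
    consists of its lower end, which belongs to H because H is closed. *)
Lemma gap_lower H w : closed H -> ~ H w -> exists l : seq R,
  (forall a, a \in l -> H a /\ a < w) /\
  (forall t, H t -> t < w -> exists2 a, a \in l & t <= a).
Proof.
move=> cH nHw; have [[t0 [Ht0 t0w]]|nt] := pselect (exists t, H t /\ t < w);
  last by exists [::]; split=> // t Ht tw; case: nt; exists t.
pose S := [set t | H t /\ t < w].
have S0 : S !=set0 by exists t0.
have uS : ubound S w by move=> t [_ /ltW].
have hS : has_sup S by split=> //; exists w.
have Hs : H (sup S).
  apply: cH; have := closure_sup S0 (proj2 hS).
  by apply: closureS => t [].
exists [:: sup S]; split.
  move=> a; rewrite inE => /eqP ->; split=> //.
  rewrite lt_neqAle ge_sup// andbT; by apply/eqP => sw; rewrite sw in Hs.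
move=> t Ht tw; exists (sup S); first by rewrite inE.
by apply: ub_le_sup; [exact: (proj2 hS)|split].
Qed.

Lemma gap_upper H w : closed H -> ~ H w -> exists l : seq R,
  (forall a, a \in l -> H a /\ w < a) /\
  (forall t, H t -> w < t -> exists2 a, a \in l & a <= t).
Proof.
move=> cH nHw; have [|/=|l [lH lw]] := @gap_lower (-%R @^-1` H) (- w).
- by apply: closed_comp => // t _; exact: opp_continuous.
- by rewrite opprK.
exists (map -%R l); split.
  by move=> a /mapP[b /lH[Hb bw] ->]; split=> //; rewrite ltrNr.
move=> t Ht wt; have [||a al ta] := lw (- t).
- by rewrite /= opprK.
- by rewrite ltrN2.
by exists (- a); [exact: map_f|rewrite lerNl].
Qed.

Lemma seq_separation (A B : seq R) :
  (forall a b, a \in A -> b \in B -> a < b) ->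
  exists z, (forall a, a \in A -> a < z) /\ (forall b, b \in B -> z < b).
Proof.
have above a : forall B' : seq R, (forall b, b \in B' -> a < b) ->
    exists2 z, a < z & forall b, b \in B' -> z < b.
  elim=> [|b B' IH] aB; first by exists (a + 1) => //; rewrite ltrDl.
  have [|z az zB] := IH; first by move=> c cB; apply: aB; rewrite inE cB orbT.
  have ab : a < b by apply: aB; rewrite inE eqxx.
  exists (Num.min z ((a + b) / 2)); first by rewrite lt_min az midf_lt.
  move=> c; rewrite inE => /predU1P[->|/zB zc]; rewrite gt_min ?zc//.
  by rewrite midf_lt// orbT.
elim: A => [|a A IH] AB.
  have [a aB] : exists a, forall b, b \in B -> a < b.
    elim: B {AB} => [|b B [a aB]]; first by exists 0.
    exists (Num.min a (b - 1)) => c; rewrite inE gt_min.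
    by move=> /predU1P[->|/aB ->//]; rewrite ltrBlDr ltrDl ltr01 orbT.
  by have [z _ zB] := above a B aB; exists z.
have [|z [Az zB]] := IH; first by move=> x b xA; apply: AB; rewrite inE xA orbT.
have [az|za] := ltP a z.
  by exists z; split=> // x; rewrite inE => /predU1P[->|/Az].
have [|z' az' z'B] := above a B; first by move=> b; apply: AB; rewrite inE eqxx.
exists z'; split=> // x; rewrite inE => /predU1P[->//|/Az xz].
by rewrite (lt_trans xz)// (le_lt_trans za).
Qed.

(** The back-and-forth step.  The hypothesis orders the points u i + h and
    u j + h' in the same way as u' i + h and u' j + h'. *)
Lemma cut_transfer (I : finType) H (u u' : I -> R) : closed H ->
  (forall i j, same_cut (diff_set H H) (u i - u j) (u' i - u' j)) ->
  forall z, exists z', forall i, same_cut H (z - u i) (z' - u' i).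
Proof.
move=> cH uu z.
(* If z is a translate of a point of H, the same translate of that point on
   the other side is forced. *)
have [[i Hi]|nH] := pselect (exists i, H (z - u i)).
  exists (u' i + (z - u i)) => j t Ht.
  have /(uu i j) : diff_set H H (t - (z - u i)) by exists t => //; exists (z - u i).
  congr (Num.sg _ = Num.sg _); lra.
have nHi i : ~ H (z - u i) by move=> Hi; apply: nH; exists i.
(* Otherwise z lies in a gap of each translate; A and B collect the lower and
   the upper ends of the corresponding gaps on the other side. *)
have [A [AH HA]] : exists A : seq R,
    (forall a, a \in A -> exists i t, [/\ H t, t < z - u i & a = u' i + t]) /\
    (forall i t, i \in enum I -> H t -> t < z - u i ->
       exists2 a, a \in A & u' i + t <= a).
  elim: (enum I) => [|i s [A [AH HA]]]; first by exists [::].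
  have [l [lH Hl]] := gap_lower _ _ cH (nHi i).
  exists ([seq u' i + t | t <- l] ++ A); split.
    move=> a; rewrite mem_cat => /orP[/mapP[t /lH[Ht tz] ->]|/AH//].
    by exists i, t.
  move=> j t; rewrite inE => /predU1P[->|js] Ht tz.
    have [a al ta] := Hl _ Ht tz; exists (u' i + a); last by rewrite lerD2l.
    by rewrite mem_cat map_f.
  by have [a aA ta] := HA _ _ js Ht tz; exists a => //; rewrite mem_cat aA orbT.
have [B [BH HB]] : exists B : seq R,
    (forall b, b \in B -> exists i t, [/\ H t, z - u i < t & b = u' i + t]) /\
    (forall i t, i \in enum I -> H t -> z - u i < t ->
       exists2 b, b \in B & b <= u' i + t).
  elim: (enum I) => [|i s [B [BH HB]]]; first by exists [::].
  have [l [lH Hl]] := gap_upper _ _ cH (nHi i).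
  exists ([seq u' i + t | t <- l] ++ B); split.
    move=> a; rewrite mem_cat => /orP[/mapP[t /lH[Ht tz] ->]|/BH//].
    by exists i, t.
  move=> j t; rewrite inE => /predU1P[->|js] Ht tz.
    have [a al ta] := Hl _ Ht tz; exists (u' i + a); last by rewrite lerD2l.
    by rewrite mem_cat map_f.
  by have [a aB ta] := HB _ _ js Ht tz; exists a => //; rewrite mem_cat aB orbT.
have [|z' [Az zB]] := seq_separation A B.
  move=> _ _ /AH[i [t [Ht tz ->]]] /BH[j [r [Hr zr ->]]].
  have /(uu i j) : diff_set H H (r - t) by exists r => //; exists t.
  have /ltr0_sg -> : u i - u j - (r - t) < 0 by lra.
  by move/esym/eqP; rewrite sgr_cp0 => ?; lra.
exists z' => i t Ht; have iI : i \in enum I by rewrite mem_enum.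
have [tz|zt|tz] := ltgtP t (z - u i).
- have [a /Az az ta] := HA _ _ iI Ht tz.
  by rewrite !gtr0_sg//; lra.
- have [b /zB zb bt] := HB _ _ iI Ht zt.
  by rewrite !ltr0_sg//; lra.
- by case: (nHi i); rewrite -tz.
Qed.

End Cuts.

(** * Definable sets are determined by cuts of linear forms *)

Lemma update_update {T : Type} (e : nat -> T) i x y :
  update (update e i x) i y = update e i y.
Proof. by apply/funext => j; rewrite /update; case: eqP. Qed.

Lemma update_swap {T : Type} (e : nat -> T) {i j} x y : i != j ->
  update (update e i x) j y = update (update e j y) i x.
Proof.
move=> ij; apply/funext => k; rewrite /update.
by case: eqP => // ->; rewrite eq_sym (negbTE ij).
Qed.

Lemma choice2 {I T : Type} {P Q : I -> T -> Prop} :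
  (forall i, exists2 x, P i x & Q i x) ->
  exists f, forall i, P i (f i) /\ Q i (f i).
Proof.
move=> PQ; have [|f fPQ] := @boolp.choice _ _ (fun i x => P i x /\ Q i x).
  by move=> i; have [x Px Qx] := PQ i; exists x.
by exists f.
Qed.

(** The sets in which cuts are taken.  The closure conditions are up to
    supersets, which is harmless since a larger set gives a finer relation. *)
Record cut_family {R : realType} (GG : set (set R)) : Prop := CutFamily {
  cut_family_closed : forall G, GG G -> closed G;
  cut_family_thin : forall G, GG G -> exists n, iter n limit_point G `<=` set0;
  cut_family0 : exists2 G, GG G & G 0;
  cut_familyU : forall G H, GG G -> GG H -> exists2 K, GG K & G `|` H `<=` K;
  cut_familyB : forall G H, GG G -> GG H ->
    exists2 K, GG K & diff_set G H `<=` K }.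

Section CutFamily.
Context {R : realType} {GG : set (set R)}.
Hypothesis cfG : cut_family GG.

(** The scalars that the family allows form a ring, so they need not be
    prescribed: the integers are always among them. *)
Definition cut_scalar (k : R) :=
  forall G, GG G -> exists2 H, GG H & [set k * g | g in G] `<=` H.

Lemma cut_scalar0 : cut_scalar 0.
Proof.
move=> G _; have [H GH H0] := cut_family0 _ cfG; exists H => // _ [g _ <-].
by rewrite mul0r.
Qed.

Lemma cut_scalar1 : cut_scalar 1.
Proof. by move=> G GG_G; exists G => // _ [g Gg <-]; rewrite mul1r. Qed.

Lemma cut_scalarM k l : cut_scalar k -> cut_scalar l -> cut_scalar (k * l).
Proof.
move=> sk sl G /sl[H /sk[K GK HK] GH]; exists K => // _ [g Gg <-].
by rewrite -mulrA; apply: HK; exists (l * g) => //; apply: GH; exists g.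
Qed.

Lemma cut_scalarB k l : cut_scalar k -> cut_scalar l -> cut_scalar (k - l).
Proof.
move=> sk sl G GG_G; have [H GG_H GH] := sk _ GG_G; have [K GG_K GK] := sl _ GG_G.
have [L GG_L HKL] := cut_familyB _ cfG _ _ GG_H GG_K; exists L => // _ [g Gg <-].
rewrite mulrBl; apply: HKL; exists (k * g); first by apply: GH; exists g.
by exists (l * g) => //; apply: GK; exists g.
Qed.

Lemma cut_scalarN k : cut_scalar k -> cut_scalar (- k).
Proof. by rewrite -sub0r; apply: cut_scalarB; exact: cut_scalar0. Qed.

Lemma cut_scalarD k l : cut_scalar k -> cut_scalar l -> cut_scalar (k + l).
Proof.
by move=> sk sl; rewrite -[l]opprK; apply: cut_scalarB => //; exact: cut_scalarN.
Qed.

Lemma cut_family_bound (I : finType) (A : I -> set R) :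
  (forall i, exists2 G, GG G & A i `<=` G) ->
  exists2 G, GG G & forall i, A i `<=` G.
Proof.
move=> AG; suff [G GG_G AsG] : exists2 G, GG G &
    forall i, i \in enum I -> A i `<=` G.
  by exists G => // i; apply: AsG; rewrite mem_enum.
elim: (enum I) => [|i s [G GG_G AsG]].
  by have [G ? _] := cut_family0 _ cfG; exists G.
have [H GG_H AiH] := AG i; have [K GG_K GHK] := cut_familyU _ cfG _ _ GG_G GG_H.
exists K => // j; rewrite inE => /predU1P[->|/AsG AjG] x Ajx; apply: GHK.
  by right; exact: AiH.
by left; exact: AjG.
Qed.

(** The linear forms in the variables, with coefficients among the scalars,
    described only by how they depend on each single variable, which is all
    that the elimination of one variable uses. *)
Definition form (f : (nat -> R) -> R) := forall i, exists2 a, cut_scalar a &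
  forall e y, f (update e i y) = a * y + f (update e i 0).

Lemma form_var i : form (fun e => e i).
Proof.
move=> j; have [->|ij] := eqVneq j i.
  exists 1; first exact: cut_scalar1.
  by move=> e y; rewrite /update eqxx mul1r addr0.
exists 0; first exact: cut_scalar0.
by move=> e y; rewrite /update eq_sym (negbTE ij) mul0r add0r.
Qed.

Lemma form0 : form (fun=> 0).
Proof. by move=> i; exists 0 => [|e y]; [exact: cut_scalar0|rewrite mul0r addr0]. Qed.

Lemma formZ k f : cut_scalar k -> form f -> form (fun e => k * f e).
Proof.
move=> sk ff i; have [a sa fa] := ff i; exists (k * a); first exact: cut_scalarM.
by move=> e y; rewrite fa; lra.
Qed.

Lemma formB f g : form f -> form g -> form (fun e => f e - g e).
Proof.
move=> ff fg i; have [a sa fa] := ff i; have [b sb gb] := fg i.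
exists (a - b); first exact: cut_scalarB.
by move=> e y; rewrite fa gb; lra.
Qed.

Lemma form_update f i : form f -> form (fun e => f (update e i 0)).
Proof.
move=> ff j; have [->|ij] := eqVneq j i.
  by exists 0 => [|e y]; [exact: cut_scalar0|rewrite !update_update mul0r add0r].
have [a sa fa] := ff j; exists a => // e y.
by rewrite (update_swap e y 0 ij) (update_swap e 0 0 ij) fa.
Qed.

Lemma form_sum (I : finType) (f : I -> (nat -> R) -> R) :
  (forall i, form (f i)) -> form (fun e => \sum_i f i e).
Proof.
move=> ff j; have [a af] := choice2 (fun i => ff i j).
exists (\sum_i a i).
  elim/big_ind: _ => [||i _]; [exact: cut_scalar0|exact: cut_scalarD|by have [] := af i].
move=> e y; rewrite mulr_suml -big_split; apply: eq_bigr => i _.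
by have [_ ->] := af i.
Qed.

(** Differences of coordinates are for order relations, coordinates themselves
    for subsets of powers of a set below the family. *)
Definition cut_determined {n} (P : set ('I_n -> R)) := exists2 G, GG G &
  forall v w, (forall i, same_cut G (v i) (w i)) ->
    (forall i j, same_cut G (v i - v j) (w i - w j)) -> P v <-> P w.

Record cut_structure (N : fo_structure R) : Prop := CutStructure {
  cut_structure_fun : forall f : Defs.fsym N, exists2 a : 'I_(far f) -> R,
    (forall i, cut_scalar (a i)) & forall v, fint v = \sum_i a i * v i;
  cut_structure_rel : forall r : rsym N, cut_determined (@rint _ N r) }.

Section Formulas.
Context {N : fo_structure R}.
Hypothesis csN : cut_structure N.

Lemma form_eval (t : term N) : form (fun e => Defs.eval e t).
Proof.
elim: t => [i|f t IHt] /=; first exact: form_var.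
have [a sa fa] := cut_structure_fun _ csN f.
rewrite (_ : (fun e => _) = fun e => \sum_i a i * Defs.eval e (t i)).
  by apply: form_sum => i; apply: formZ.
by apply/funext => e; rewrite fa.
Qed.

(** One set G serves for all forms, because the family is directed. *)
Definition cut_invariant (P : set (nat -> R)) :=
  exists (I : finType) (f : I -> (nat -> R) -> R) (G : set R),
    [/\ GG G, forall i, form (f i) & forall e e',
      (forall i, same_cut G (f i e) (f i e')) -> P e -> P e'].

(** The scalars need not be closed under division, so the coefficients of the
    quantified variable are made equal by multiplication instead. *)
Lemma common_multiple (I : finType) (a : I -> R) : (forall i, cut_scalar (a i)) ->
  exists c (b : I -> R), [/\ c != 0, forall i, cut_scalar (b i) &
    forall i, a i != 0 -> b i != 0 /\ b i * a i = c].
Proof.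
move=> sa; exists (\prod_(i | a i != 0) a i).
exists (fun i => \prod_(j | (a j != 0) && (j != i)) a j); split.
- by apply/prodf_neq0.
- by move=> i; elim/big_ind: _; [exact: cut_scalar1|exact: cut_scalarM|].
- move=> i ai; split; first by apply/prodf_neq0 => j /andP[].
  by rewrite mulrC [RHS](bigD1 i).
Qed.

(** Elimination of a quantifier.  After multiplication by b j, the forms that
    involve the variable y become c * y - l j for a common c <> 0, and
    cut_transfer applies to z = c * y.  The new forms are the differences of
    the l j, together with the forms at y = 0. *)
Lemma cut_invariant_forall i (P : set (nat -> R)) : cut_invariant P ->
  cut_invariant [set e | forall y, P (update e i y)].
Proof.
move=> [I [f [G [GG_G ff fP]]]].
have [a af] := choice2 (fun j => ff j i).
have sa j : cut_scalar (a j) by have [] := af j.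
have fa j e y : f j (update e i y) = a j * y + f j (update e i 0).
  by have [_] := af j; exact.
have [c [b [c0 sb bac]]] := common_multiple _ _ sa.
have [H GG_H bGH] := cut_family_bound _ _ (fun j => sb j _ GG_G).
have [D GG_D HHD] := cut_familyB _ cfG _ _ GG_H GG_H.
have [K GG_K GDK] := cut_familyU _ cfG _ _ GG_G GG_D.
pose l j (e : nat -> R) := - b j * f j (update e i 0).
have fl j : form (l j).
  by apply: formZ; [exact: cut_scalarN|exact: form_update].
exists (I + I * I)%type, (fun s => match s with
  | inl j => fun e => f j (update e i 0)
  | inr (j, k) => fun e => l j e - l k e end), K.
split=> // [[j|[j k]]|e e' ee' Pe y']; [exact: form_update|exact: formB|].
have Kf j : same_cut G (f j (update e i 0)) (f j (update e' i 0)).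
  by apply: same_cutS (ee' (inl j)) => t Gt; apply: GDK; left.
have Kl j k : same_cut (diff_set H H) (l j e' - l k e') (l j e - l k e).
  apply: same_cut_sym; apply: same_cutS (ee' (inr (j, k))) => t Ht.
  by apply: GDK; right; exact: HHD.
have [z zl] := cut_transfer _ _ (fun j => l j e') (fun j => l j e) (cut_family_closed _ cfG _ GG_H) Kl (c * y').
apply: fP (Pe (z / c)) => j; have [aj|aj] := eqVneq (a j) 0.
  by rewrite fa aj [X in same_cut _ _ X]fa aj !mul0r !add0r.
have [bj bajc] := bac j aj; apply: (@same_cut_scale _ (b j) G H) => //.
have fE e0 y : b j * f j (update e0 i y) = c * y - l j e0.
  by rewrite fa -bajc /l; ring.
by rewrite !fE mulrCA divff// mulr1; apply: same_cut_sym.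
Qed.

Lemma cut_invariant_imp (P Q : set (nat -> R)) :
  cut_invariant P -> cut_invariant Q -> cut_invariant [set e | P e -> Q e].
Proof.
move=> [I [f [G [GG_G ff fP]]]] [J [g [H [GG_H fg gQ]]]].
have [K GG_K GHK] := cut_familyU _ cfG _ _ GG_G GG_H.
exists (I + J)%type, (fun s => match s with inl i => f i | inr j => g j end), K.
split=> // [[i|j]//|e e' ee' PQ Pe'].
apply: (gQ e) => [j|].
  by apply: same_cutS (ee' (inr j)) => t ?; apply: GHK; right.
apply: PQ; apply: fP Pe' => i; apply: same_cut_sym.
by apply: same_cutS (ee' (inl i)) => t ?; apply: GHK; left.
Qed.

Lemma cut_invariant_sat (p : formula N) : cut_invariant (fun e => sat e p).
Proof.
elim: p => [|t u|r t|p IHp q IHq|i p IHp] /=.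
- have [G GG_G _] := cut_family0 _ cfG.
  by exists void, (fun=> fun=> 0), G; split=> // i; exact: form0.
- have [G GG_G G0] := cut_family0 _ cfG.
  exists unit, (fun=> fun e => Defs.eval e t - Defs.eval e u), G; split=> // [_|e e'].
    by apply: formB; exact: form_eval.
  move=> /(_ tt 0 G0) + tu; rewrite tu !subr0 subrr sgr0 => /esym/eqP.
  by rewrite sgr_eq0 subr_eq0 => /eqP.
- have [G GG_G rG] := cut_structure_rel _ csN r.
  exists ('I_(rar r) + 'I_(rar r) * 'I_(rar r))%type, (fun s => match s with
    | inl j => fun e => Defs.eval e (t j)
    | inr (j, k) => fun e => Defs.eval e (t j) - Defs.eval e (t k) end), G.
  split=> // [[j|[j k]]|e e' ee']; [exact: form_eval|by apply: formB; exact: form_eval|].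
  have [|j k|//] := rG (fun j => Defs.eval e (t j)) (fun j => Defs.eval e' (t j)).
    by move=> j; exact: (ee' (inl j)).
  exact: (ee' (inr (j, k))).
- exact: (cut_invariant_imp _ _ IHp IHq).
- exact: (cut_invariant_forall i _ IHp).
Qed.

Lemma assign_snoc n (x : 'I_n -> R) y (c : nat -> R) :
  assign (snoc x y) c = update (assign (snoc x 0) c) n y.
Proof.
apply/funext => i; rewrite /assign /update.
have [->|ni] := eqVneq i n.
  rewrite insubT//= => ?; rewrite /snoc; case: unliftP => //= j.
  move=> /(congr1 val) /=; rewrite /bump leqNgt ltn_ord add0n => nj.
  by have := ltn_eqF (ltn_ord j); rewrite -nj eqxx.
case: insubP => // j _ ji; rewrite /snoc; case: unliftP => //= jE.
by move: ni; rewrite -ji jE /= eqxx.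
Qed.

(** If a point y of the fibre makes no form that depends on y fall into G, all
    cuts are locally constant at y and the fibre is a neighbourhood of y.
    Otherwise the fibre lies in the union of the preimages of G under finitely
    many nonconstant affine maps, whose rank is bounded by that of G,
    independently of the parameters. *)
Theorem cut_structure_d_minimal : d_minimal N.
Proof.
move=> n A [p [c Ac]].
have [I [f [G [GG_G ff fp]]]] := cut_invariant_sat p.
have cG := cut_family_closed _ cfG _ GG_G.
have [m Gm] := cut_family_thin _ cfG _ GG_G.
have [a af] := choice2 (fun j => ff j n).
have fa j e y : f j (update e n y) = a j * y + f j (update e n 0).
  by have [_] := af j; exact.
exists m.+1; split=> // x; have [|nint] := pselect ((fiber A x)° !=set0); first by left.
right; pose e y := update (assign (snoc x 0) c) n y.
have fE y : fiber A x y <-> sat (e y) p.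
  by rewrite /e -assign_snoc; exact: Ac.
have ce j : continuous (fun y => f j (e y)).
  rewrite (_ : (fun y => _) = fun y => a j * y + f j (e 0)).
    move=> y; apply: cvgD; last exact: cvg_cst.
    by apply: cvgM; [exact: cvg_cst|exact: cvg_id].
  by apply/funext => y; rewrite fa.
apply: (@union_of_discrete_sub _ _ _
  (\bigcup_(j : {j | a j != 0}) (fun y => f (sval j) (e y)) @^-1` G)).
  move=> y Ay; apply: contrapT => yG; apply: nint; exists y.
  have near_y j : \forall y' \near y, same_cut G (f j (e y)) (f j (e y')).
    have [aj|aj] := eqVneq (a j) 0.
      by apply: (@nearW _ (nbhs y)) => y' t _; rewrite /e (fa j _ y) (fa j _ y') aj !mul0r.
    apply: (ce j y); apply: near_same_cut => // Gy; apply: yG.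
    by exists (exist _ j aj).
  have near_all : nbhs y [set y' | forall j, same_cut G (f j (e y)) (f j (e y'))].
    exact: (@filter_forall _ _ _ (nbhs y) _ near_y).
  by apply: filterS near_all => y' yy'; apply/fE; apply: fp yy' _; apply/fE.
apply: derived_bigcup0 => -[j aj].
apply: subset_trans; first apply: (derived_preimage _ (ce j)).
  move=> y y' /eqP; rewrite /e (fa j _ y) (fa j _ y') (inj_eq (addIr _)) => /eqP.
  exact: mulfI.
by move=> y /(derived_widen _ m _ cG (leqnSn m)) /Gm.
Qed.

End Formulas.
End CutFamily.

(** * Sums of a definable countable set and a thin compact set *)

Section CompactThin.
Context {R : realType}.
Implicit Types K L : set R.

Definition compact_thin K :=
  compact K /\ exists n, iter n limit_point K `<=` set0.

Lemma real_accessible : accessible_space R.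
Proof. exact: hausdorff_accessible (@order_hausdorff _ R). Qed.

Lemma real_pair_accessible : accessible_space (R * R)%type.
Proof. exact: hausdorff_accessible (@norm_hausdorff _ (R * R)%type). Qed.

Lemma compact_thinU K L :
  compact_thin K -> compact_thin L -> compact_thin (K `|` L).
Proof.
move=> [cK [m K0]] [cL [n L0]]; split; first exact: compactU.
exists (m + n)%N; apply: subset_trans (derivedU _ _ _) _; rewrite subUset; split.
  apply: subset_trans K0; apply: derived_widen (leq_addr _ _).
  exact: compact_closed (@order_hausdorff _ R) cK.
apply: subset_trans L0; apply: derived_widen (leq_addl _ _).
exact: compact_closed (@order_hausdorff _ R) cL.
Qed.

Lemma compact_thin1 (x : R) : compact_thin [set x].
Proof.
split; first exact: compact_set1.
exists 1%N => /= y xy.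
have [z [/eqP zy -> _]] := xy setT filterT.
have /xy : nbhs y (~` [set x]).
  apply: open_nbhs_nbhs; split; last first.
    by move=> yx; have [w [/eqP wy wx _]] := xy setT filterT; apply: wy; rewrite wx yx.
  exact/closed_openC/closed_eq.
by move=> [w [_ wx]]; apply.
Qed.

Lemma compact_thin_diff K L :
  compact_thin K -> compact_thin L -> compact_thin (diff_set K L).
Proof.
move=> [cK [m K0]] [cL [n L0]].
have hR := @order_hausdorff _ R.
have -> : diff_set K L = (fun p : R * R => p.1 - p.2) @` (K `*` L).
  apply/seteqP; split=> [_ [k Kk [l Ll <-]]|_ [[k l] [Kk Ll] <-]].
    by exists (k, l).
  by exists k => //; exists l.
have cont : continuous (fun p : R * R => p.1 - p.2).
  by move=> p; apply: cvgB; [exact: cvg_fst|exact: cvg_snd].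
have cKL : compact (K `*` L) by exact: compact_setX.
have [clK clL] : closed K /\ closed L by split; exact: compact_closed hR _.
split; first by apply: continuous_compact => //; exact: continuous_subspaceT.
exists (m + n)%N; apply: subset_trans.
  apply: derived_image => //; [exact: real_pair_accessible|exact: closedX|].
  exact: compact_locally_proper.
by move=> x [p /(derivedX _ _ _ _ real_accessible real_accessible clK clL K0 L0)].
Qed.

Lemma compact_thin_scale (k : R) K :
  compact_thin K -> compact_thin [set k * x | x in K].
Proof.
move=> [cK [n K0]]; have hR := @order_hausdorff _ R.
have cont : continuous (fun x : R => k * x).
  by move=> x; apply: cvgM; [exact: cvg_cst|exact: cvg_id].
split; first by apply: continuous_compact => //; exact: continuous_subspaceT.
exists n; apply: subset_trans.
  apply: derived_image => //; first exact: real_accessible.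
    exact: compact_closed hR cK.
  exact: compact_locally_proper.
by move=> y [x /K0].
Qed.

Definition sum_set (P K : set R) : set R := [set p + k | p in P & k in K].

(** Addition is locally proper on P * K: if p + k is near z and k is bounded,
    then p is in a compact part of P. *)
Lemma sum_set_closed_thin P K : limit_point P `<=` set0 -> compact_thin K ->
  closed (sum_set P K) /\ exists n, iter n limit_point (sum_set P K) `<=` set0.
Proof.
move=> P0 [cK [n K0]].
have hR := @order_hausdorff _ R.
have clK : closed K by exact: compact_closed hR cK.
have clP : closed P.
  by move=> x; rewrite closure_isolated_limit_point => -[[/set_mem]|/P0].
have -> : sum_set P K = (fun p : R * R => p.1 + p.2) @` (P `*` K).
  apply/seteqP; split=> [_ [k Kk [l Ll <-]]|_ [[k l] [Kk Ll] <-]].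
    by exists (k, l).
  by exists k => //; exists l.
have cont : continuous (fun p : R * R => p.1 + p.2).
  by move=> p; apply: cvgD; [exact: cvg_fst|exact: cvg_snd].
have clPK : closed (P `*` K) by exact: closedX.
have pPK : locally_proper (fun p : R * R => p.1 + p.2) (P `*` K).
  move=> z; exists (ball z 1); first exact: nbhsx_ballx.
  have [B [_ KB]] := compact_bounded cK.
  (* Boundedness of K only gives |k| <= b for b > B. *)
  pose b := B + 1.
  exists ((P `&` `[z - (1 + b), z + (1 + b)]) `*` K).
    apply: compact_setX => //.
    apply: subclosed_compact (@segment_compact _ (z - (1 + b)) (z + (1 + b))) _.
      by apply: closedI => //; exact: itv_closed.
    by move=> x [].
  move=> [p k] [/= [Pp Kk]]; rewrite /ball/= ltr_norml => /andP[zl zr].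
  have := KB b; rewrite /b ltrDl => /(_ ltr01 _ Kk) /=; rewrite ler_norml => /andP[kl kr].
  by do 2!split=> //=; rewrite in_itv/=; apply/andP; split; lra.
split; first exact: locally_proper_closed.
exists (1 + n)%N; apply: subset_trans.
  by apply: derived_image => //; exact: real_pair_accessible.
by move=> x [p /(derivedX _ _ 1 n real_accessible real_accessible clP clK P0 K0)].
Qed.

End CompactThin.

(** * Sets defined by a formula in one variable *)

Section Definable.
Context {R : realType} {N : fo_structure R}.
Hypothesis (zeroN : exists t : term N, forall e, Defs.eval e t = 0).
Hypothesis (addN : forall t u : term N,
  exists w : term N, forall e, Defs.eval e w = Defs.eval e t + Defs.eval e u).
Implicit Types (P Q : set R) (p q : formula N).

Definition or_formula p q := Imp (Imp p (Bot N)) q.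
Definition and_formula p q := Imp (Imp p (Imp q (Bot N))) (Bot N).
Definition ex_formula i p := Imp (All i (Imp p (Bot N))) (Bot N).

Lemma sat_or e p q : sat e (or_formula p q) <-> sat e p \/ sat e q.
Proof.
split=> /= [pq|[]//].
by have [|/pq] := pselect (sat e p); [left|right].
Qed.

Lemma sat_and e p q : sat e (and_formula p q) <-> sat e p /\ sat e q.
Proof.
split=> /= [npq|[pe qe]]; last by apply.
by apply: contrapT => pq; apply: npq => pe qe; exact: pq.
Qed.

Lemma sat_ex e i p : sat e (ex_formula i p) <-> exists x, sat (update e i x) p.
Proof.
split=> /= [np|[x px]]; last by move/(_ x).
by apply: contrapT => ex; apply: np => x px; apply: ex; exists x.
Qed.

(** The family p consists of copies of one formula with free variable k, all
    quantified variables being larger than k; formulas can then be combined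
    without renaming of variables. *)
Definition formula_set P :=
  exists p : nat -> formula N, forall k e, sat e (p k) <-> P (e k).

Lemma formula_set_definable P : formula_set P -> definable N (unary_set P).
Proof.
move=> [p pP]; exists (p 0%N), (fun=> 0) => x; rewrite pP /unary_set /=.
by rewrite /assign insubT//= (_ : Sub 0%N _ = ord0)//; exact: val_inj.
Qed.

Lemma formula_set0 : formula_set [set 0].
Proof. by have [t t0] := zeroN; exists (fun k => Eq (Var N k) t) => k e /=; rewrite t0. Qed.

Lemma formula_setU P Q : formula_set P -> formula_set Q -> formula_set (P `|` Q).
Proof.
move=> [p pP] [q qQ]; exists (fun k => or_formula (p k) (q k)) => k e.
by rewrite sat_or pP qQ.
Qed.

Lemma formula_set_diff P Q :
  formula_set P -> formula_set Q -> formula_set (diff_set P Q).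
Proof.
move=> [p pP] [q qQ].
have [s sE] : exists s : nat -> term N,
    forall k e, Defs.eval e (s k) = e k + e k.+2.
  by have [s ?] := choice (fun k => addN (Var N k) (Var N k.+2)); exists s.
exists (fun k => ex_formula k.+1 (ex_formula k.+2 (and_formula
  (and_formula (p k.+1) (q k.+2)) (Eq (Var N k.+1) (s k))))) => k e.
have kk : (k == k.+1) = false by rewrite -addn1 -[X in X == _]addn0 eqn_add2l.
have kk2 : (k == k.+2) = false by rewrite -addn2 -[X in X == _]addn0 eqn_add2l.
have eE x y : let e' := update (update e k.+1 x) k.+2 y in
    [/\ e' k = e k, e' k.+1 = x & e' k.+2 = y].
  by rewrite /= /update !eqxx kk kk2 eqSS kk.
rewrite sat_ex; split=> [[x /sat_ex[y]]|[x Px [y Qy xy]]].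
  have [e0 e1 e2] := eE x y.
  rewrite !sat_and pP qQ /= sE e0 e1 e2 => -[[Px Qy] xE].
  by exists x => //; exists y => //; rewrite xE addrK.
exists x; apply/sat_ex; exists y; have [e0 e1 e2] := eE x y.
rewrite !sat_and pP qQ /= sE e0 e1 e2 -xy; split=> //.
by rewrite subrK.
Qed.

Lemma formula_set_scale (k : R) P :
  (forall t : term N, exists w : term N, forall e, Defs.eval e w = k * Defs.eval e t) ->
  formula_set P -> formula_set [set k * x | x in P].
Proof.
move=> scaleN [p pP].
have [s sE] : exists s : nat -> term N, forall i e, Defs.eval e (s i) = k * e i.+1.
  by have [s ?] := choice (fun i => scaleN (Var N i.+1)); exists s.
exists (fun i => ex_formula i.+1
  (and_formula (p i.+1) (Eq (Var N i) (s i)))) => i e.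
have ii : (i == i.+1) = false by rewrite -addn1 -[X in X == _]addn0 eqn_add2l.
have eE x : update e i.+1 x i = e i /\ update e i.+1 x i.+1 = x.
  by rewrite /update eqxx ii.
rewrite sat_ex; split=> [[x]|[x Px kx]].
  by rewrite sat_and pP /= sE; have [-> ->] := eE x; move=> [Px ->]; exists x.
by exists x; rewrite sat_and pP /= sE; have [-> ->] := eE x; rewrite kx.
Qed.

End Definable.

Lemma countableU {T : Type} (X Y : set T) :
  countable X -> countable Y -> countable (X `|` Y).
Proof.
by move=> cX cY; rewrite -bigcup2inE; apply: bigcup_countable => // -[|[|]].
Qed.

Section LocallyOMinimal.
Context {R : realType}.

Lemma open_open_interval (a b : \bar R) : open (open_interval a b).
Proof.
rewrite (_ : open_interval a b =
  EFin @^-1` ([set y | (a < y)%E] `&` [set y | (y < b)%E]))//.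
apply: open_comp; last first.
  by apply: openI; [exact: open_ereal_gt_ereal|exact: open_ereal_lt_ereal].
by move=> y _; apply: cvg_EFin; [exact: nearW|exact: cvg_id].
Qed.

(** A nonempty interval has positive length. *)
Lemma countable_open_interval (X : set R) (a b : \bar R) :
  countable X -> open_interval a b `<=` X -> open_interval a b = set0.
Proof.
move=> cX abX; apply/seteqP; split=> // x [ax xb].
have : nbhs x (open_interval a b).
  by apply: open_nbhs_nbhs; split=> //; exact: open_open_interval.
move=> /nbhs_ballP[r /= r0 rab].
have : countable `]x - r, x + r[%classic.
  apply: sub_countable cX; apply: subset_card_le; apply: subset_trans abX.
  by move: rab; rewrite ball_itv.
move=> /countable_lebesgue_measure0; rewrite lebesgue_measure_itv/= lte_fin.
by rewrite ifT; [|lra]; rewrite -EFinD => -[]; lra.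
Qed.

(** Near any point P is a finite union of points and intervals, and the
    intervals are empty since P is countable. *)
Lemma locally_o_minimal_limit_point (N : fo_structure R) (P : set R) :
  locally_o_minimal N -> definable N (unary_set P) -> countable P ->
  limit_point P `<=` set0.
Proof.
move=> lN dP cP a aP; have [b [c [[ba ac] [s [t E]]]]] := lN P dP a.
have U0 : \bigcup_(p in [set` t]) open_interval p.1 p.2 = set0 :> set R.
  apply/seteqP; split=> // x [[p q] /= pt xpq].
  suff pq0 : open_interval p q = set0 by rewrite /= pq0 in xpq.
  apply: (@countable_open_interval P) => // y ypq.
  suff : (P `&` open_interval b c) y by case.
  by rewrite E; right; exists (p, q).
have /(proj1 (limit_point_infinite_setP P a) aP) : nbhs a (open_interval b c).
  by apply: open_nbhs_nbhs; split=> //; exact: open_open_interval.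
apply; rewrite setIC E U0 setU0; exact: finite_seq.
Qed.

End LocallyOMinimal.

(** * The structures on the ordered group and the ordered vector space *)

Section TameSums.
Context {R : realType} {N : fo_structure R}.
Hypothesis N_lomin : locally_o_minimal N.
Hypothesis zeroN : exists t : term N, forall e, Defs.eval e t = 0.
Hypothesis addN : forall t u : term N,
  exists w : term N, forall e, Defs.eval e w = Defs.eval e t + Defs.eval e u.

(** Countability of P is kept alongside definability since together they are
    stable under the operations below and exclude limit points, whereas the
    difference of two closed discrete sets can be dense. *)
Definition tame_sum : set (set R) := [set G | exists P K : set R,
  [/\ countable P, @formula_set R N P, compact_thin K & G = sum_set P K]].

Lemma tame_sum_closed_thin G : tame_sum G ->
  closed G /\ exists n, iter n limit_point G `<=` set0.
Proof.
move=> [P [K [cP fP cK ->]]]; apply: sum_set_closed_thin => //.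
exact: locally_o_minimal_limit_point N_lomin (formula_set_definable _ fP) cP.
Qed.

Lemma tame_sum_cut_family : cut_family tame_sum.
Proof.
split.
- by move=> G /tame_sum_closed_thin[].
- by move=> G /tame_sum_closed_thin[].
- exists (sum_set [set 0] [set 0]).
    exists [set 0], [set 0]; split=> //; first exact: formula_set0.
    exact: compact_thin1.
  by exists 0 => //; exists 0 => //; rewrite addr0.
- move=> _ _ [P [K [cP fP cK ->]]] [Q [L [cQ fQ cL ->]]].
  exists (sum_set (P `|` Q) (K `|` L)).
    exists (P `|` Q), (K `|` L); split=> //.
    + exact: countableU.
    + exact: formula_setU.
    + exact: compact_thinU.
  by move=> x [] [p Pp [k Kk <-]]; exists p;
    [left| exists k; [left|] |right|exists k; [right|]].
- move=> _ _ [P [K [cP fP cK ->]]] [Q [L [cQ fQ cL ->]]].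
  exists (sum_set (diff_set P Q) (diff_set K L)).
    exists (diff_set P Q), (diff_set K L); split=> //.
    + rewrite (_ : diff_set P Q = (fun p => p.1 - p.2) @` (P `*` Q)).
        exact: (sub_countable (card_image_le _ _) (countableX cP cQ)).
      apply/seteqP; split=> [_ [k Kk [l Ll <-]]|_ [[k l] [Kk Ll] <-]].
        by exists (k, l).
      by exists k => //; exists l.
    + exact: formula_set_diff.
    + exact: compact_thin_diff.
  move=> _ [_ [p Pp [k Kk <-]] [_ [q Qq [l Ll <-]] <-]].
  exists (p - q); first by exists p => //; exists q.
  by exists (k - l); [exists k => //; exists l|ring].
Qed.

Lemma tame_sum_scalar (k : R) :
  (forall t : term N,
    exists w : term N, forall e, Defs.eval e w = k * Defs.eval e t) ->
  cut_scalar (GG := tame_sum) k.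
Proof.
move=> scaleN _ [P [K [cP fP cK ->]]].
exists (sum_set [set k * x | x in P] [set k * x | x in K]).
  exists [set k * x | x in P], [set k * x | x in K]; split=> //.
  - exact: (sub_countable (card_image_le _ _) cP).
  - exact: formula_set_scale.
  - exact: compact_thin_scale.
move=> _ [_ [p Pp [q Kq <-]] <-]; rewrite mulrDr.
by exists (k * p); [exists p|exists (k * q) => //; exists q].
Qed.

End TameSums.

(** Covers both languages: the function symbols are linear with coefficients
    that act on terms, and the relation symbols compare two arguments.  The
    predicates for subsets of powers of F are determined by cuts in the set
    (D `|` [set 0]) + (E `|` [set 0]), which contains F. *)
Theorem linear_sharp_d_minimal (R : realType) (M : fo_structure R) (D E : set R) :
  (forall f : Defs.fsym M, exists2 a : 'I_(far f) -> R,
    (forall i (t : term (expand_set M D)), exists w : term (expand_set M D),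
       forall e, Defs.eval e w = a i * Defs.eval e t) &
    forall v, fint v = \sum_i a i * v i) ->
  (forall r : rsym M, exists i j, forall v, rint (r := r) v <-> v i < v j) ->
  (exists t : term (expand_set M D), forall e, Defs.eval e t = 0) ->
  (forall t u : term (expand_set M D), exists w : term (expand_set M D),
     forall e, Defs.eval e w = Defs.eval e t + Defs.eval e u) ->
  countable D -> locally_o_minimal (expand_set M D) ->
  compact E -> (exists N, union_of_discrete N E) ->
  d_minimal (sharp M (D `|` E)).
Proof.
move=> Mfun Mrel zeroN addN cD lD cE [n En].
have cf := tame_sum_cut_family lD zeroN addN.
apply: (cut_structure_d_minimal cf); split.
  move=> f; have [a sa fa] := Mfun f; exists a => // i.
  exact: tame_sum_scalar.
case=> [r|s].
  have [i [j rE]] := Mrel r; have [G GG_G G0] := cut_family0 _ cf.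
  exists G => // v w _ /(_ i j 0 G0); rewrite !subr0 => vw.
  have vwE : (v i < v j) = (w i < w j).
    by rewrite -subr_lt0 -sgr_lt0 vw sgr_lt0 subr_lt0.
  by split=> /rE ltv; apply/rE; [rewrite -vwE|rewrite vwE].
have GF : tame_sum (N := expand_set M D) (sum_set (D `|` [set 0]) (E `|` [set 0])).
  exists (D `|` [set 0]), (E `|` [set 0]); split=> //.
  - by apply: countableU => //; exact: finite_set_countable.
  - apply: formula_setU; last exact: formula_set0.
    by exists (fun k => @Rel R (expand_set M D) (inr tt) (fun=> Var _ k)).
  - apply: compact_thinU; last exact: compact_thin1.
    split=> //; exists n; apply: closed_union_of_discrete En.
    exact: compact_closed (@order_hausdorff _ R) cE.
have FG : D `|` E `<=` sum_set (D `|` [set 0]) (E `|` [set 0]).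
  move=> x [Dx|Ex]; [exists x; [by left|]|exists 0; [by right|]].
    by exists 0; [right|rewrite addr0].
  by exists x; [left|rewrite add0r].
exists (sum_set (D `|` [set 0]) (E `|` [set 0])) => //.
move=> v w vw _; split=> /= sv.
  suff -> : w = v by [].
  by apply/funext => i; apply: (same_cut_mem _ _ _ (vw i)); apply: FG; exact: (sharp_set_sub sv).
suff -> : v = w by [].
apply/funext => i; apply: (same_cut_mem _ _ _ (same_cut_sym _ _ _ (vw i))).
by apply: FG; exact: (sharp_set_sub sv).
Qed.

Lemma group_fint_linear {R : realType} (f : group_fsym) (v : 'I_(group_far f) -> R) :
  group_fint v = \sum_i 1 * v i.
Proof.
case: f v => v /=; first by rewrite big_ord0.
by rewrite !big_ord_recl big_ord0 !mul1r addr0; congr (_ + v _); exact: val_inj.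
Qed.

Theorem theorem1p5 (R : realType) (M : fo_structure R)
    (hM : M = ordered_group R \/ M = ordered_vspace R)
    (D : set R) (D_countable : countable D)
    (D_lomin : locally_o_minimal (expand_set M D))
    (E : set R) (E_compact : compact E)
    (E_discrete : exists N : nat, union_of_discrete N E) :
  d_minimal (sharp M (D `|` E)).
Proof.
apply: linear_sharp_d_minimal => //; case: hM => {M D_lomin} ->.
- move=> f; exists (fun=> 1); last exact: group_fint_linear.
  by move=> _ t; exists t => e; rewrite mul1r.
- case=> [f|l].
    exists (fun=> 1); last exact: group_fint_linear.
    by move=> _ t; exists t => e; rewrite mul1r.
  exists (fun=> l) => [_ t|v]; last by rewrite big_ord1.
  by exists (@App R (expand_set (ordered_vspace R) D) (inr l) (fun=> t)).
- by move=> r; exists ord0, ord_max.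
- by move=> r; exists ord0, ord_max.
- by exists (@App R (expand_set (ordered_group R) D) GZero (fun=> Var _ 0%N)).
- by exists (@App R (expand_set (ordered_vspace R) D) (inl GZero) (fun=> Var _ 0%N)).
- move=> t u; exists (@App R (expand_set (ordered_group R) D) GAdd
    (fun j : 'I_2 => if j == ord0 then t else u)).
  by move=> e /=.
- move=> t u; exists (@App R (expand_set (ordered_vspace R) D) (inl GAdd)
    (fun j : 'I_2 => if j == ord0 then t else u)).
  by move=> e /=.
Qed.
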